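(* Let $R$ and $S$ be left commutative rngs and let $f:R\to S$ be a left commutative rng homomorphism. Then the map $$f^{\sharp}: P\mapsto f^{-1}(P)\quad\text{for } P\in\mathrm{spec}^{\sharp}S$$ is continuous from $\mathrm{spec}^{\sharp}S$ to $\mathrm{spec}^{\sharp}R$ (in particular $f^{-1}(P)\in\mathrm{spec}^{\sharp}R$ for every $P\in\mathrm{spec}^{\sharp}S$), and, for $\varepsilon=0,1$, the restriction $f^{\sharp}|_{\mathrm{spec}^{\sharp}_{\varepsilon}S}$ is continuous from the subspace $\mathrm{spec}^{\sharp}_{\varepsilon}S$ of $\mathrm{spec}^{\sharp}S$ to the subspace $\mathrm{spec}^{\sharp}_{\varepsilon}R$ of $\mathrm{spec}^{\sharp}R$.
   Context: A rng is an associative ring not assumed to have an identity; ''ring'' means a ring with identity. A left commutative rng $(R,+,\cdot,\sharp)$ is a rng $(R,+,\cdot)$ such that: (i) $xyz=yxz$ for all $x,y,z\in R$; (ii) there is a left identity $1^{\ell}\in R$, i.e. $1^{\ell}x=x$ for all $x\in R$; (iii) on the additive halo $\hbar^+(R):=\{x\in R : x1^{\ell}=0\}$ (which does not depend on the choice of left identity) there is given a binary operation $\sharp$, the local product, such that $(\hbar^+(R),+,\sharp)$ is a commutative ring with an identity $1^{\sharp}$, the local identity; (iv) $(x\alpha)\,\sharp\,\beta=x(\alpha\,\sharp\,\beta)$ for all $\alpha,\beta\in\hbar^+(R)$, $x\in R$. The bar-unit set of $R$ is $\hbar^{\times}(R):=\{b\in R : bx=x \text{ for all } x\in R\}$. A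 left commutative rng homomorphism $\phi:R\to \bar R$ between left commutative rngs with local identities $1^{\sharp}$ and $\bar 1^{\sharp}$ is a map satisfying $\phi(x+y)=\phi(x)+\phi(y)$, $\phi(xy)=\phi(x)\phi(y)$ for $x,y\in R$; $\phi(\hbar^{\times}(R))\cap\hbar^{\times}(\bar R)\neq\emptyset$; $\phi(\alpha\,\sharp\,\beta)=\phi(\alpha)\,\sharp\,\phi(\beta)$ for $\alpha,\beta\in\hbar^+(R)$; and $\phi(1^{\sharp})=\bar 1^{\sharp}$. (The first three conditions imply $\phi(\hbar^+(R))\subseteq\hbar^+(\bar R)$, so the fourth makes sense.) An ideal of $R$ is an additive subgroup $I$ with $RI\subseteq I$, $IR\subseteq I$ and $I\cap\hbar^+(R)$ an ideal of the ring $(\hbar^+(R),+,\sharp)$. A Hu-Liu prime ideal of $R$ is an ideal $P\neq R$ such that: (i) for $x,y\in R$, $xy\in P+\hbar^+(R)$ implies $x\in P+\hbar^+(R)$ or $y\in P+\hbar^+(R)$; (ii) for $x,y\in R$, $xy\in P$ implies $x\in P+\hbar^+(R)$ or $y\in P$; (iii) $P\supseteq\hbar^+(R)$, or $P\cap\hbar^+(R)$ is a prime ideal of the commutative ring $(\hbar^+(R),+,\sharp)$. The set of all Hu-Liu prime ideals of $R$ is denoted $\mathrm{spec}^{\sharp}R$. The even spectrum is $\mathrm{spec}^{\sharp}_0R:=\{P\in\mathrm{spec}^{\sharp}R : P\supseteq\hbar^+(R)\}$ and the odd spectrum is $\mathrm{spec}^{\sharp}_1R:=\{P\in\mathrm{spec}^{\sharp}R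 : P\not\supseteq\hbar^+(R)\}$. The expanded Zariski topology on $\mathrm{spec}^{\sharp}R$ is the topology whose closed sets are exactly the sets $\mathcal V(I):=\{P\in\mathrm{spec}^{\sharp}R : P\supseteq I\}$, $I$ an ideal of $R$. All spectra carry this topology. *)

(* Defs.v *)
From HB Require Import structures.
From mathcomp Require Import all_boot all_order all_algebra.
From mathcomp Require Import all_classical topology.

Set Implicit Arguments.
Unset Strict Implicit.
Unset Printing Implicit Defensive.

Import GRing.Theory.
Local Open Scope classical_set_scope.
Local Open Scope ring_scope.

(* The multiplication of a rng is the operation [*%g] of its multiplicative
   semigroup: the product [*%R] would require an identity. *)
Notation "x ** y" := (x * y)%g (at level 40, left associativity).

HB.mixin Record Zmodule_Semigroup_isRng R of GRing.Zmodule R & Semigroup R := {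
  rng_mulDl : forall x y z : R, (x + y) ** z = x ** z + y ** z;
  rng_mulDr : forall x y z : R, x ** (y + z) = x ** y + x ** z
}.

#[short(type="rngType")]
HB.structure Definition Rng :=
  { R of GRing.Zmodule R & Semigroup R & Zmodule_Semigroup_isRng R }.

Section RngTheory.
Variable R : rngType.
Implicit Types x y : R.

Lemma rng_mul0r x : 0 ** x = 0.
Proof. by apply: (@addrI _ (0 ** x)); rewrite -rng_mulDl !addr0. Qed.

Lemma rng_mulr0 x : x ** 0 = 0.
Proof. by apply: (@addrI _ (x ** 0)); rewrite -rng_mulDr !addr0. Qed.

Lemma rng_mulNr x y : (- x) ** y = - (x ** y).
Proof.
by apply: (@addrI _ (x ** y)); rewrite -rng_mulDl !subrr rng_mul0r.
Qed.

Lemma rng_mulBl x y z : (x - y) ** z = x ** z - y ** z.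
Proof. by rewrite rng_mulDl rng_mulNr. Qed.

End RngTheory.

(* A left identity is chosen once and for all.  Nothing below depends on the
   choice (see [haloE]) and homomorphisms need not preserve it. *)
HB.mixin Record Rng_isLeftCommutative R of Rng R := {
  lid : R;
  lid_mul : forall x : R, lid ** x = x;
  rng_mulCA : forall x y z : R, x ** y ** z = y ** x ** z
}.

#[short(type="preLcRngType")]
HB.structure Definition PreLcRng := { R of Rng R & Rng_isLeftCommutative R }.

Definition halo_pred (R : preLcRngType) : {pred R} :=
  fun x => x ** lid == 0.
Arguments halo_pred : clear implicits.

Definition barunit (R : preLcRngType) : set R :=
  [set b : R | forall x : R, b ** x = x].
Arguments barunit : clear implicits.

Lemma haloE (R : preLcRngType) (e : R) :
  barunit R e -> forall x : R, (x \in halo_pred R) = (x ** e == 0).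
Proof.
move=> he x; rewrite unfold_in; apply/eqP/eqP => h.
  by rewrite -(lid_mul e) mulgA h rng_mul0r.
by rewrite -(he lid) mulgA h rng_mul0r.
Qed.

Lemma halo_zmod_closed (R : preLcRngType) : zmod_closed (halo_pred R).
Proof.
split; first by rewrite unfold_in rng_mul0r.
move=> x y; rewrite !unfold_in => /eqP hx /eqP hy.
by rewrite rng_mulBl hx hy subrr.
Qed.

HB.instance Definition _ (R : preLcRngType) :=
  GRing.isZmodClosed.Build R (halo_pred R) (@halo_zmod_closed R).

(* The additive halo, as a type. *)
Record halo (R : preLcRngType) := Halo {
  halo_val : R;
  haloP : halo_val \in halo_pred R
}.

HB.instance Definition _ (R : preLcRngType) := [isSub for @halo_val R].
HB.instance Definition _ (R : preLcRngType) := [Choice of halo R by <:].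
HB.instance Definition _ (R : preLcRngType) :=
  [SubChoice_isSubZmodule of halo R by <:].

Lemma halo_actP (R : preLcRngType) (x : R) (a : halo R) :
  x ** halo_val a \in halo_pred R.
Proof.
by rewrite unfold_in -mulgA; move/eqP: (haloP a) => ->; rewrite rng_mulr0.
Qed.

Definition halo_act (R : preLcRngType) (x : R) (a : halo R) : halo R :=
  Halo (halo_actP x a).

HB.mixin Record PreLcRng_hasLocalProduct R of PreLcRng R := {
  lprod : halo R -> halo R -> halo R;
  lone : halo R;
  lprodA : associative lprod;
  lprodC : commutative lprod;
  lprod1r : left_id lone lprod;
  lprodDl : left_distributive lprod +%R;
  lprod_act : forall (x : R) (a b : halo R),
    lprod (halo_act x a) b = halo_act x (lprod a b)
}.

#[short(type="lcRngType")]
HB.structure Definition LcRng :=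
  { R of PreLcRng R & PreLcRng_hasLocalProduct R }.

(* The additive halo as a commutative ring: there [*%R] is the local product
   and [1] the local identity. *)
Definition haloRing (R : lcRngType) : Type := halo R.

HB.instance Definition _ (R : lcRngType) :=
  GRing.Zmodule.copy (haloRing R) (halo R).
HB.instance Definition _ (R : lcRngType) :=
  GRing.Zmodule_isComPzRing.Build (haloRing R)
    (@lprodA R) (@lprodC R) (@lprod1r R) (@lprodDl R).

(* Ideals, possibly improper, of a commutative ring. *)
Definition ring_ideal (A : comPzRingType) (I : set A) : Prop :=
  [/\ I 0, (forall a b, I a -> I b -> I (a - b)) &
      (forall a b, I b -> I (a * b))].

Definition ring_prime_ideal (A : comPzRingType) (I : set A) : Prop :=
  [/\ ring_ideal I, I <> setT &
      (forall a b, I (a * b) -> I a \/ I b)].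

Section Spectrum.
Variable R : lcRngType.
Implicit Types (I J P : set R) (x y : R).

Definition halo_set : set R := [set x | x \in halo_pred R].

(* The trace of [I] on the additive halo, as a subset of the halo ring. *)
Definition halo_trace I : set (haloRing R) := [set a | I (halo_val a)].

Definition lc_ideal I : Prop :=
  [/\ I 0 /\ (forall x y, I x -> I y -> I (x - y)),
      (forall x y, I y -> I (x ** y)),
      (forall x y, I x -> I (x ** y)) &
      ring_ideal (halo_trace I)].

(* The set [P + halo]. *)
Definition add_halo P : set R :=
  [set x | exists p, exists2 a, P p /\ halo_set a & x = p + a].

Definition hu_liu_prime P : Prop :=
  [/\ lc_ideal P /\ P <> setT,
      (forall x y, add_halo P (x ** y) -> add_halo P x \/ add_halo P y),
      (forall x y, P (x ** y) -> add_halo P x \/ P y) &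
      halo_set `<=` P \/ ring_prime_ideal (halo_trace P)].

Record spec := Spec {
  spec_set :> set R;
  specP : hu_liu_prime spec_set
}.

HB.instance Definition _ := gen_eqMixin spec.
HB.instance Definition _ := gen_choiceMixin spec.

(* The set V(I). *)
Definition zariski_closed I : set spec := [set P | I `<=` spec_set P].

Definition zariski_open (U : set spec) : Prop :=
  exists2 I, lc_ideal I & U = ~` zariski_closed I.

Lemma halo_split x : halo_set (x - x ** lid).
Proof.
by rewrite /halo_set /= unfold_in rng_mulBl -mulgA lid_mul subrr.
Qed.

Lemma lc_idealI I J : lc_ideal I -> lc_ideal J -> lc_ideal (I `&` J).
Proof.
move=> [[I0 IB] Il Ir [_ _ Ih]] [[J0 JB] Jl Jr [_ _ Jh]].
split; [split| | |split].
- by split.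
- by move=> x y [? ?] [? ?]; split; [exact: IB|exact: JB].
- by move=> x y [? ?]; split; [exact: Il|exact: Jl].
- by move=> x y [? ?]; split; [exact: Ir|exact: Jr].
- by split.
- by move=> a b [? ?] [? ?]; split; [exact: IB|exact: JB].
- by move=> a b [? ?]; split; [exact: Ih|exact: Jh].
Qed.

Lemma lc_ideal_bigcap (F : set (set R)) :
  F `<=` lc_ideal -> lc_ideal (\bigcap_(I in F) I).
Proof.
move=> FI; split; [split| | |split].
- by move=> I /FI[[]].
- by move=> x y hx hy I FI'; have [[_ h] _ _ _] := FI _ FI'; apply: h;
    [exact: hx|exact: hy].
- by move=> x y hy I FI'; have [_ h _ _] := FI _ FI'; apply: h; exact: hy.
- by move=> x y hx I FI'; have [_ _ h _] := FI _ FI'; apply: h; exact: hx.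
- by move=> I /FI[[]].
- by move=> a b ha hb I FI'; have [[_ h] _ _ _] := FI _ FI'; apply: h;
    [exact: ha|exact: hb].
- by move=> a b hb I FI'; have [_ _ _ [_ _ h]] := FI _ FI'; apply: h;
    exact: hb.
Qed.

Lemma lc_idealT : lc_ideal setT.
Proof. by []. Qed.

Lemma lc_ideal_add I x y : lc_ideal I -> I x -> I y -> I (x + y).
Proof.
move=> [[I0 IB] _ _ _] Ix Iy; rewrite -[y]opprK -[- y]add0r.
by apply: (IB _ _ Ix); exact: IB.
Qed.

Lemma add_haloP P x : lc_ideal P -> add_halo P x -> P (x ** lid).
Proof.
move=> [_ _ Pr _] [p [a [Pp]]]; rewrite /halo_set /= unfold_in => /eqP ha ->.
by rewrite rng_mulDl ha addr0; exact: Pr.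
Qed.

Lemma add_halo_even P x :
  lc_ideal P -> halo_set `<=` P -> add_halo P x -> P x.
Proof.
by move=> iP hP [p [a [Pp ha] ->]]; apply: lc_ideal_add => //; exact: hP.
Qed.

Lemma sub_of_halo I P : lc_ideal I -> lc_ideal P ->
  I `<=` add_halo P -> I `&` halo_set `<=` P -> I `<=` P.
Proof.
move=> [[I0 IB] Il Ir _] iP IP hIP x Ix.
rewrite -[x](subrK (x ** lid)); apply: lc_ideal_add => //.
  by apply: hIP; split; [apply: (IB _ _ Ix); exact: Ir|exact: halo_split].
by apply: add_haloP => //; exact: IP.
Qed.

Lemma zariski_closedI I J : lc_ideal I -> lc_ideal J ->
  zariski_closed (I `&` J) = zariski_closed I `|` zariski_closed J.
Proof.
move=> iI iJ; apply/seteqP; split=> [P IJP|P [] h x [Ix Jx]]; [|exact: h|exact: h].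
have [[iP _] _ P2 P3] := specP P.
have IJm x y : I x -> J y -> spec_set P (x ** y).
  move=> Ix Jy; apply: IJP; case: iI iJ => _ _ Ir _ [_ Jl _ _].
  by split; [exact: Ir|exact: Jl].
have JIm x y : I x -> J y -> spec_set P (y ** x).
  move=> Ix Jy; apply: IJP; case: iI iJ => _ Il _ _ [_ _ Jr _].
  by split; [exact: Il|exact: Jr].
have [|nIP] := pselect (I `<=` spec_set P); first by left.
right; apply: contrapT => nJP.
have JaP : J `<=` add_halo P.
  move=> y Jy; apply: contrapT => ny; apply: nIP => x Ix.
  by have [//|] := P2 _ _ (JIm _ _ Ix Jy).
have IaP : I `<=` add_halo P.
  move=> x Ix; apply: contrapT => nx; apply: nJP => y Jy.
  by have [//|] := P2 _ _ (IJm _ _ Ix Jy).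
case: P3 => [hP|[_ _ prP]].
  by apply: nIP => x /IaP; exact: add_halo_even.
have [IhP|nIhP] := pselect (I `&` halo_set `<=` spec_set P).
  by apply: nIP; exact: sub_of_halo.
apply: nJP; apply: sub_of_halo => // y [Jy hy].
apply: contrapT => nPy; apply: nIhP => x [Ix hx].
pose a : haloRing R := Halo hx; pose b : haloRing R := Halo hy.
have /prP[] // : halo_trace P (a * b).
apply: IJP; case: iI iJ => _ _ _ [_ _ Ih] [_ _ _ [_ _ Jh]]; split.
  by rewrite mulrC; exact: (Ih b a).
exact: (Jh a b).
Qed.

Lemma zariski_open_setT : zariski_open setT.
Proof.
exists setT; first exact: lc_idealT.
rewrite -[LHS]setC0; congr (~` _); apply/seteqP; split=> // P TP.
by have [[_ nT] _ _ _] := specP P; apply: nT; apply/seteqP; split.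
Qed.

Lemma zariski_open_setI : setI_closed zariski_open.
Proof.
move=> _ _ [I iI ->] [J iJ ->]; exists (I `&` J); first exact: lc_idealI.
by rewrite zariski_closedI // setCU.
Qed.

Lemma zariski_open_bigU (T : Type) (U : T -> set spec) :
  (forall i, zariski_open (U i)) -> zariski_open (\bigcup_i U i).
Proof.
move=> oU.
have /boolp.choice[I IU] : forall i, exists J,
    lc_ideal J /\ U i = ~` zariski_closed J.
  by move=> i; have [J iJ UJ] := oU i; exists J.
exists (\bigcap_(J in [set J | lc_ideal J /\ forall i, I i `<=` J]) J).
  by apply: lc_ideal_bigcap => J [].
apply/seteqP; split=> [P [i _]|P].
  rewrite (IU i).2 => nP h; apply: nP => x Ix.
  by apply: h => J [_ IJ]; exact: (IJ i).
move=> nP; apply: contrapT => nU; apply: nP => x; apply.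
split=> [|i]; first by have [[]] := specP P.
apply: contrapT => nIi; apply: nU; exists i => //.
by rewrite (IU i).2.
Qed.

(* The expanded Zariski topology; see [zariski_closedP]. *)
HB.instance Definition _ := isOpenTopological.Build spec
  zariski_open_setT zariski_open_setI zariski_open_bigU.

Lemma zariski_closedP (F : set spec) :
  closed F <-> exists2 I, lc_ideal I & F = zariski_closed I.
Proof.
rewrite -openC; split=> [[I iI FI]|[I iI ->]]; exists I => //.
by rewrite -[LHS]setCK FI setCK.
Qed.

Definition spec_even : set spec := [set P | halo_set `<=` spec_set P].
Definition spec_odd : set spec := [set P | ~ halo_set `<=` spec_set P].

(* [false] stands for 0 and [true] for 1. *)
Definition spec_part (eps : bool) : set spec :=
  if eps then spec_odd else spec_even.

End Spectrum.

Arguments halo_set : clear implicits.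
Arguments spec_part : clear implicits.

(* The conditions of a homomorphism that do not mention the local products. *)
Record bar_hom (R S : lcRngType) (f : R -> S) : Prop := BarHom {
  bar_homD : forall x y, f (x + y) = f x + f y;
  bar_homM : forall x y, f (x ** y) = f x ** f y;
  bar_hom_barunit : f @` barunit R `&` barunit S !=set0
}.

Lemma bar_hom_halo (R S : lcRngType) (f : R -> S) (hf : bar_hom f)
  (a : halo R) : f (halo_val a) \in halo_pred S.
Proof.
have [_ [[e eR <-] eS]] := bar_hom_barunit hf.
rewrite (haloE eS) -(bar_homM hf); move: (haloP a); rewrite (haloE eR).
move=> /eqP ->; apply/eqP; apply: (@addrI _ (f 0)).
by rewrite -(bar_homD hf) !addr0.
Qed.

Definition halo_map (R S : lcRngType) (f : R -> S) (hf : bar_hom f)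
  (a : haloRing R) : haloRing S := Halo (bar_hom_halo hf a).

Record lc_hom (R S : lcRngType) (f : R -> S) : Prop := LcHom {
  lc_hom_bar : bar_hom f;
  lc_homM : forall a b : haloRing R,
    halo_map lc_hom_bar (a * b) = halo_map lc_hom_bar a * halo_map lc_hom_bar b;
  lc_hom1 : halo_map lc_hom_bar 1 = 1
}.

(* Main.v *)
Require Import Defs.
From HB Require Import structures.
From mathcomp Require Import all_boot all_order all_algebra.
From mathcomp Require Import all_classical topology.

(** Why preimages of Hu-Liu primes are Hu-Liu primes.  The delicate point is
    that the primality conditions speak of [P + halo], and [f] is not assumed
    surjective, so preimages need not commute with such sums.  They do here:
    writing [x = x ** e + (x - x ** e)] with [e] a bar-unit, the second term
    lies in the halo, so [x] is in [P + halo] exactly when [x ** e] is in [P]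
    ([add_haloE]).  This membership is tested by a single product, and [f]
    sends some bar-unit to a bar-unit, so it is compatible with [f]
    ([add_halo_preimage]).  The first two primality conditions then pull back
    verbatim.  On the halos, [f] induces a homomorphism of commutative unital
    rings, and the third condition is the classical fact about preimages of
    prime ideals ([ring_prime_ideal_preimage]).

    Evenness clearly pulls back.  Oddness does because the trace of [P] on the
    halo ring is an ideal: [P] is even as soon as it contains the local
    identity, and [f] preserves the local identity ([spec_even_preimage]).

    Continuity holds because [f @^-1` P] contains an ideal [I] iff [P] contains
    the ideal generated by the image of [I]. *)

Import GRing.Theory.
Local Open Scope classical_set_scope.
Local Open Scope ring_scope.

(** * Preimages of ideals of commutative rings *)

Lemma ring_ideal_neqT {A : comPzRingType} {I : set A} :
  ring_ideal I -> I <> setT <-> ~ I 1.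
Proof.
move=> [_ _ Im]; split=> [nT I1|nI1 IT]; last by apply: nI1; rewrite IT.
by apply: nT; apply/seteqP; split=> // a _; rewrite -[a]mulr1; exact: Im.
Qed.

(* Unital homomorphisms are given here by their equations, the form in which
   [lc_hom] provides them on the halo rings. *)
Section RingPreimage.
Context {A B : comPzRingType} {g : A -> B}.
Hypotheses (gB : forall a b, g (a - b) = g a - g b)
  (gM : forall a b, g (a * b) = g a * g b).

Lemma ring_ideal_preimage {I : set B} :
  ring_ideal I -> ring_ideal (g @^-1` I).
Proof.
move=> [I0 IB Im]; split=> [|a b Ia Ib|a b Ib] /=.
- by rewrite -(subrr 0) gB subrr.
- by rewrite gB; exact: IB.
- by rewrite gM; exact: Im.
Qed.

Lemma ring_prime_ideal_preimage {I : set B} :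
  g 1 = 1 -> ring_prime_ideal I -> ring_prime_ideal (g @^-1` I).
Proof.
move=> g1 [iI nT Ip]; split; first exact: ring_ideal_preimage.
- move=> fT; move/(ring_ideal_neqT iI): nT; apply.
  by rewrite -g1 -[I _]/((g @^-1` I) 1) fT.
- by move=> a b; rewrite /= gM => /Ip.
Qed.

End RingPreimage.

(** * Bar-units and sums with the halo *)

(** Since [e ** e' = e'], the element [x ** e'] is a right multiple of
    [x ** e]. *)
Lemma lc_ideal_mulr_barunit {R : lcRngType} {P : set R} {e e' x : R} :
  lc_ideal P -> barunit R e -> P (x ** e) -> P (x ** e').
Proof. by move=> [_ _ Pr _] he Pxe; rewrite -(he e') mulgA; exact: Pr. Qed.

(** Membership in [P + halo] becomes a test on one product, which multiplicative
    maps respect. *)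
Lemma add_haloE {R : lcRngType} {P : set R} {e x : R} :
  lc_ideal P -> barunit R e -> add_halo P x <-> P (x ** e).
Proof.
have lidU : barunit R lid := lid_mul.
move=> iP he; split=> [/(add_haloP iP)|Pxe].
  exact: lc_ideal_mulr_barunit.
exists (x ** lid); exists (x - x ** lid); last by rewrite addrC subrK.
by split; [exact: (lc_ideal_mulr_barunit iP he)|exact: halo_split].
Qed.

(** The trace on the halo ring is an ideal, hence full once it contains the
    local identity. *)
Lemma halo_sub_lone {R : lcRngType} {P : set R} :
  lc_ideal P -> halo_set R `<=` P <-> halo_trace P 1.
Proof.
move=> [_ _ _ [_ _ Pm]]; split=> [|P1 x hx]; first by apply; exact: haloP.
have := Pm (Halo hx : haloRing R) 1 P1.
by rewrite mulr1.
Qed.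

(** * Preimages of Hu-Liu prime ideals *)

Section Preimage.
Context {R S : lcRngType} {f : R -> S} (hf : lc_hom f).

Let fbar := lc_hom_bar hf.

Lemma lc_homB x y : f (x - y) = f x - f y.
Proof. by apply: (addIr (f y)); rewrite -(bar_homD fbar) !subrK. Qed.

Lemma halo_mapB (a b : haloRing R) :
  halo_map fbar (a - b) = halo_map fbar a - halo_map fbar b.
Proof. by apply: val_inj; exact: lc_homB. Qed.

Lemma halo_trace_preimage (P : set S) :
  halo_trace (f @^-1` P) = halo_map fbar @^-1` halo_trace P.
Proof. by []. Qed.

Lemma lc_ideal_preimage {P : set S} : lc_ideal P -> lc_ideal (f @^-1` P).
Proof.
move=> [[P0 PB] Pl Pr Ph]; split; [split| | |] => /=.
- by rewrite -(subrr 0) lc_homB subrr.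
- by move=> x y Px Py /=; rewrite lc_homB; exact: PB.
- by move=> x y Py /=; rewrite (bar_homM fbar); exact: Pl.
- by move=> x y Px /=; rewrite (bar_homM fbar); exact: Pr.
- rewrite halo_trace_preimage.
  exact: (ring_ideal_preimage halo_mapB (lc_homM hf)).
Qed.

Lemma add_halo_preimage {P : set S} (x : R) :
  lc_ideal P -> add_halo (f @^-1` P) x <-> add_halo P (f x).
Proof.
move=> iP; have [_ [[e eR <-] eS]] := bar_hom_barunit fbar.
apply: (iff_trans (add_haloE (lc_ideal_preimage iP) eR)).
rewrite /= (bar_homM fbar).
exact: iff_sym (add_haloE iP eS).
Qed.

(** If the preimage were everything, [P] would contain a bar-unit [b], hence
    every [y = b ** y]. *)
Lemma lc_ideal_preimage_neqT {P : set S} :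
  lc_ideal P -> P <> setT -> f @^-1` P <> setT.
Proof.
move=> [_ _ Pr _] nT fT; have [_ [[e _ <-] eS]] := bar_hom_barunit fbar.
apply: nT; apply/seteqP; split=> // y _; rewrite -(eS y); apply: Pr.
by rewrite -[P _]/((f @^-1` P) e) fT.
Qed.

Lemma spec_even_preimage {P : set S} :
  lc_ideal P -> halo_set R `<=` f @^-1` P <-> halo_set S `<=` P.
Proof.
move=> iP; apply: (iff_trans (halo_sub_lone (lc_ideal_preimage iP))).
apply: (iff_trans _ (iff_sym (halo_sub_lone iP))).
by rewrite halo_trace_preimage /preimage /= (lc_hom1 hf).
Qed.

Lemma hu_liu_prime_preimage {P : set S} :
  hu_liu_prime P -> hu_liu_prime (f @^-1` P).
Proof.
move=> [[iP nT] P1 P2 P3]; split.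
- by split; [exact: lc_ideal_preimage|exact: lc_ideal_preimage_neqT].
- move=> x y /(add_halo_preimage _ iP); rewrite (bar_homM fbar) => /P1[] h.
    by left; exact/add_halo_preimage.
  by right; exact/add_halo_preimage.
- move=> x y /=; rewrite (bar_homM fbar) => /P2[] h; last by right.
  by left; exact/add_halo_preimage.
- case: P3 => [hP|pP]; [left; exact/spec_even_preimage|right].
  rewrite halo_trace_preimage.
  exact: (ring_prime_ideal_preimage halo_mapB (lc_homM hf) (lc_hom1 hf)).
Qed.

Definition spec_preimage (P : spec S) : spec R :=
  Spec (hu_liu_prime_preimage (specP P)).

(** * Continuity *)

(** The image of [I] under [f] need not be an ideal, hence the intersection:
    it is the ideal generated by this image. *)
Lemma spec_preimage_closed (I : set R) :
  spec_preimage @^-1` zariski_closed I =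
  zariski_closed (\bigcap_(J in [set J | lc_ideal J /\ f @` I `<=` J]) J).
Proof.
apply/seteqP; split=> P /= h.
  move=> y; apply; split; first by have [[]] := specP P.
  by move=> _ [x Ix <-]; exact: h.
by move=> x Ix; apply: h => J [_]; apply; exists x.
Qed.

Lemma spec_preimage_continuous : continuous spec_preimage.
Proof.
apply/continuous_closedP => _ /zariski_closedP[I _ ->].
apply/zariski_closedP; rewrite spec_preimage_closed.
by eexists => //; apply: lc_ideal_bigcap => J [].
Qed.

Lemma spec_preimage_part {eps : bool} {P : spec S} :
  spec_part S eps P -> spec_part R eps (spec_preimage P).
Proof.
have [[iP _] _ _ _] := specP P.
case: eps; rewrite /= /spec_odd /spec_even /=;
  by rewrite (propext (spec_even_preimage iP)).
Qed.

End Preimage.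

(** A map between subspaces is continuous when it is the restriction of a
    continuous map, since their topologies are induced by the inclusions. *)
Lemma continuous_set_type {X Y : topologicalType} {A : set X} {B : set Y}
    {g : X -> Y} {h : set_type A -> set_type B} :
  (forall x, set_val (h x) = g (set_val x)) -> continuous g -> continuous h.
Proof.
move=> hg /continuousP cg; apply/continuousP => _ [U oU <-].
exists (g @^-1` U); first exact: cg.
by apply/seteqP; split=> x /=; rewrite hg.
Qed.

Theorem proposition3p3 (R S : lcRngType) (f : R -> S) (hf : lc_hom f) :
  exists fs : spec S -> spec R,
    [/\ forall P : spec S, spec_set (fs P) = f @^-1` spec_set P,
        continuous fs &
        forall eps : bool,
          exists fe : set_type (spec_part S eps) -> set_type (spec_part R eps),
            (forall P, set_val (fe P) = fs (set_val P)) /\ continuous fe].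
Proof.
exists (spec_preimage hf); split=> // [|eps].
  exact: spec_preimage_continuous.
pose fe (P : set_type (spec_part S eps)) : set_type (spec_part R eps) :=
  SigSub (mem_set (spec_preimage_part hf (set_valP P))).
exists fe; split=> //.
exact: (continuous_set_type _ (spec_preimage_continuous hf)).
Qed.
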